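(* Let $A\in\mathbb R^{N\times N}$ be symmetric, $f\in\mathbb R^N$, $C\in\mathbb R^{m\times N}$ (rows possibly dependent), $g\in\mathbb R^m$, and suppose $\mathcal K_g=\{c\in\mathbb R^N:Cc=g\}$ is nonempty. Then $c$ satisfies $$c\in\mathcal K_g,\qquad v^T(Ac-f)=0\quad\forall v\in\ker C$$ if and only if there is a multiplier $\lambda\in\mathbb R^m$ such that $$\begin{bmatrix} A & C^T \\ C & 0 \end{bmatrix} \begin{bmatrix} c \\ \lambda \end{bmatrix} = \begin{bmatrix} f \\ g \end{bmatrix}.$$ If $v^TAv>0$ for every nonzero $v\in\ker C$, then $c$ is unique. If the rows of $C$ are dependent, then the multiplier $\lambda$ is not unique and the block matrix is singular in the corresponding multiplier directions: $(0,\eta)$ is a null vector of it for every $\eta\in\ker C^T$.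
   Context: In the paper $A$ is the broken Galerkin matrix, $f$ the load vector, and $Cc=g$ the smoothness and boundary equations of a spline space on broken Bernstein coefficients. Uniqueness of $c$ means that the constrained problem has at most one solution $c$; non-uniqueness of $\lambda$ means that whenever $(c,\lambda)$ solves the block system there is $\lambda'\ne\lambda$ such that $(c,\lambda')$ also solves it. *)

(* Defs.v *)
From mathcomp Require Import all_boot all_order all_algebra.
From mathcomp Require Import classical_sets reals.

Set Implicit Arguments.
Unset Strict Implicit.
Unset Printing Implicit Defensive.

Import Order.TTheory GRing.Theory Num.Theory.
Local Open Scope classical_set_scope.
Local Open Scope ring_scope.

Definition feasible_set (R : realType) (m N : nat) (C : 'M[R]_(m, N))
    (g : 'cV[R]_m) : set 'cV[R]_N :=
  [set c | C *m c = g].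

(* The kernel of v |-> C v on column vectors; MathComp's kermx is the kernel
   on row vectors. *)
Definition ker_col (R : realType) (m N : nat) (C : 'M[R]_(m, N)) :
    set 'cV[R]_N :=
  [set v | C *m v = 0].

Definition constrained_solution (R : realType) (m N : nat) (A : 'M[R]_N)
    (f : 'cV[R]_N) (C : 'M[R]_(m, N)) (g : 'cV[R]_m) (c : 'cV[R]_N) : Prop :=
  feasible_set C g c /\
  forall v : 'cV[R]_N, ker_col C v -> v^T *m (A *m c - f) = 0.

Definition saddle_mx (R : realType) (m N : nat) (A : 'M[R]_N)
    (C : 'M[R]_(m, N)) : 'M[R]_(N + m) :=
  block_mx A C^T C 0.

Definition saddle_solution (R : realType) (m N : nat) (A : 'M[R]_N)
    (f : 'cV[R]_N) (C : 'M[R]_(m, N)) (g : 'cV[R]_m)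
    (c : 'cV[R]_N) (lam : 'cV[R]_m) : Prop :=
  saddle_mx A C *m col_mx c lam = col_mx f g.

(* Main.v *)
(** The stationarity condition says that the residual [A c - f] is orthogonal to
    [ker C], and the orthogonal complement of [ker C] is the range of [C^T]; a
    multiplier is a preimage of [f - A c] under [C^T].  Multipliers can therefore be
    shifted by any element of [ker C^T], which is nonzero exactly when the rows
    of [C] are dependent. *)

Require Import Defs.
From mathcomp Require Import all_boot all_order all_algebra.
From mathcomp Require Import classical_sets reals.

Import Order.TTheory GRing.Theory Num.Theory.
Local Open Scope classical_set_scope.
Local Open Scope ring_scope.

(** [cokermx C] tests membership in the row space of [C]: orthogonality to its columns puts [r^T] in
    that space, and the transposed coefficients serve as [lam]. *)
Lemma orthogonal_ker_col (R : realType) (m N : nat) (C : 'M[R]_(m, N))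
    (r : 'cV[R]_N) :
  (forall v : 'cV[R]_N, ker_col C v -> v^T *m r = 0) <->
  exists lam : 'cV[R]_m, C^T *m lam = r.
Proof.
split=> [r_orth|[lam <-] v Cv0]; last by rewrite mulmxA -trmx_mul Cv0 trmx0 mul0mx.
have /submxP[D rE] : (r^T <= C)%MS.
  (* The columns of [cokermx C] span the kernel of [v |-> C *m v]. *)
  rewrite submxE -trmx_eq0 trmx_mul trmxK; apply/eqP/row_matrixP => i.
  rewrite row_mul -tr_col row0 r_orth // /ker_col /=.
  by rewrite colE mulmxA mulmx_coker mul0mx.
by exists D^T; rewrite -trmx_mul -rE trmxK.
Qed.

Lemma saddle_solutionE (R : realType) (m N : nat) (A : 'M[R]_N) (f : 'cV[R]_N)
    (C : 'M[R]_(m, N)) (g : 'cV[R]_m) (c : 'cV[R]_N) (lam : 'cV[R]_m) :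
  saddle_solution A f C g c lam <-> A *m c + C^T *m lam = f /\ C *m c = g.
Proof.
rewrite /saddle_solution /saddle_mx mul_block_col mul0mx addr0.
by split=> [/eq_col_mx|[-> ->]].
Qed.

Lemma constrained_solution_saddle (R : realType) (m N : nat) (A : 'M[R]_N)
    (f : 'cV[R]_N) (C : 'M[R]_(m, N)) (g : 'cV[R]_m) (c : 'cV[R]_N) :
  constrained_solution A f C g c <->
  exists lam : 'cV[R]_m, saddle_solution A f C g c lam.
Proof.
split=> [[Cc /orthogonal_ker_col[lam lamE]]|[lam /saddle_solutionE[<- Cc]]].
  (* [lam] is a preimage of [A *m c - f] under [C^T]; the first block row needs one of [f - A *m c],
     hence the sign. *)
  exists (- lam); apply/saddle_solutionE; split=> //.
  by rewrite mulmxN lamE subKr.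
split=> //; apply/orthogonal_ker_col; exists (- lam).
by rewrite mulmxN opprD addrA subrr add0r.
Qed.

(** The difference [d] of two solutions lies in [ker_col C]. Testing both stationarity conditions on
    [d] and subtracting gives [d^T A d = 0], so positivity forces [d = 0]. *)
Lemma constrained_solution_unique (R : realType) (m N : nat) (A : 'M[R]_N)
    (f : 'cV[R]_N) (C : 'M[R]_(m, N)) (g : 'cV[R]_m) (c c' : 'cV[R]_N) :
  (forall v : 'cV[R]_N, ker_col C v -> v != 0 -> 0 < (v^T *m A *m v) 0 0) ->
  constrained_solution A f C g c -> constrained_solution A f C g c' -> c = c'.
Proof.
move=> A_pos [Cc c_orth] [Cc' c'_orth]; apply/eqP; rewrite -subr_eq0.
have Cd : ker_col C (c - c') by rewrite /ker_col /= mulmxBr Cc Cc' subrr.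
apply: contraT => /(A_pos _ Cd); rewrite -mulmxA mulmxBr.
(* Inserting [f] twice leaves a difference of residuals, each orthogonal to [c - c']. *)
rewrite -[A *m c](subrK f) -[A *m c'](subrK f) opprD addrACA subrr addr0.
by rewrite mulmxBr c_orth // c'_orth // subrr mxE ltxx.
Qed.

Lemma saddle_mx_ker (R : realType) (m N : nat) (A : 'M[R]_N)
    (C : 'M[R]_(m, N)) (eta : 'cV[R]_m) :
  ker_col C^T eta -> saddle_mx A C *m col_mx 0 eta = 0.
Proof.
by move=> eta_ker; rewrite mul_block_col !mulmx0 mul0mx eta_ker !addr0 col_mx0.
Qed.

(** A linear dependency among the rows is a nonzero row vector in [kermx C]; its transpose is
    [eta]. *)
Lemma ker_col_tr_neq0 (R : realType) (m N : nat) (C : 'M[R]_(m, N)) :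
  ~~ row_free C -> exists2 eta : 'cV[R]_m, ker_col C^T eta & eta != 0.
Proof.
rewrite -kermx_eq0 => /rowV0Pn[v /sub_kermxP vC v0].
by exists v^T; rewrite ?trmx_eq0 // /ker_col /= -trmx_mul vC trmx0.
Qed.

Theorem theorem6p1 (R : realType) (N m : nat) (A : 'M[R]_N) (f : 'cV[R]_N)
    (C : 'M[R]_(m, N)) (g : 'cV[R]_m)
    (A_sym : A^T = A) (K_nonempty : feasible_set C g !=set0) :
  [/\ (forall c : 'cV[R]_N,
         constrained_solution A f C g c <->
         exists lam : 'cV[R]_m, saddle_solution A f C g c lam),
      ((forall v : 'cV[R]_N, ker_col C v -> v != 0 ->
          0 < (v^T *m A *m v) 0 0) ->
       forall c c' : 'cV[R]_N,
         constrained_solution A f C g c -> constrained_solution A f C g c' ->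
         c = c')
    & (~~ row_free C ->
       [/\ (forall (c : 'cV[R]_N) (lam : 'cV[R]_m),
              saddle_solution A f C g c lam ->
              exists2 lam' : 'cV[R]_m,
                lam' != lam & saddle_solution A f C g c lam'),
           saddle_mx A C \notin unitmx
         & forall eta : 'cV[R]_m, ker_col C^T eta ->
             saddle_mx A C *m col_mx 0 eta = 0])].
Proof.
split=> [c|A_pos c c'|/ker_col_tr_neq0[eta eta_ker eta0]].
- exact: constrained_solution_saddle.
- exact: constrained_solution_unique.
split=> [c lam sol||]; last exact: saddle_mx_ker.
- exists (lam + eta); first by rewrite -subr_eq0 addrC addKr.
  (* The new pair is [(c, lam) + (0, eta)], and the second term is a null vector. *)
  rewrite /saddle_solution -[c]addr0 -add_col_mx.
  by rewrite mulmxDr sol saddle_mx_ker ?addr0.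
(* Were the block matrix invertible, its null vector [(0, eta)] would vanish. *)
- apply: contra eta0 => /mulKmx/(_ (col_mx 0 eta)).
  rewrite saddle_mx_ker // mulmx0 => /esym/eqP.
  by rewrite col_mx_eq0 => /andP[].
Qed.
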